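(* For a real number $M\ge 1$ let $\mathcal X=\{1,2,3\}$, let $\pi=\left(\frac{M}{M+2},\frac1{M+2},\frac1{M+2}\right)$, and let $P:\mathcal X\to\mathcal X$ be the Markov kernel $$P=\begin{pmatrix}1-\frac1{4M}&\frac1{4M}&0\\ \frac14&\frac12&\frac14\\ 0&\frac14&\frac34\end{pmatrix}$$ (which is reversible with respect to $\pi$). Then, as $M\to\infty$, $$\delta(\pi,P)=O\left(\frac1{\log M}\right)\qquad\text{and}\qquad \rho_0(\pi,P)=\Theta\left(\frac{\log\log M}{\log M}\right).$$ In particular, $\frac{\rho_0(\pi,P)}{\delta(\pi,P)}=\Omega(\log\log M)$ as $M\to\infty$.
   Context: Let $\mathcal X$ be a finite set, $P$ a Markov kernel (row-stochastic matrix) on $\mathcal X$, and $\pi$ a probability distribution on $\mathcal X$ with $\pi(x)P(x,y)=\pi(y)P(y,x)$ for all $x,y$. Logarithms are natural, $0\log 0=0$. KL divergence: $D(\nu\|\pi)=\sum_x\nu(x)\log\frac{\nu(x)}{\pi(x)}$ ($+\infty$ if $\nu\not\ll\pi$). $(\nu P)(y)=\sum_x\nu(x)P(x,y)$. Full-step entropy contraction coefficient: $$\delta(\pi,P)=1-\sup_{\nu:\,0<D(\nu\|\pi)<\infty}\frac{D(\nu P\|\pi)}{D(\nu\|\pi)},$$ where $\nu$ ranges over probability distributions on $\mathcal X$. For $f:\mathcal X\to\mathbb R_{\ge0}$, $\pi[f]=\sum_x\pi(x)f(x)$ and $\mathrm{Ent}_\pi(f)=\pi\left[f\log\frac{f}{\pi[f]}\right]$.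 The Dirichlet form is $\mathcal E_{\pi,P}(f,g)=-\pi[f\cdot(P-I)g]$, so by reversibility $\mathcal E_{\pi,P}(f,\log f)=\frac12\sum_{x,y}\pi(x)P(x,y)(f(x)-f(y))(\log f(x)-\log f(y))$; when $f$ has zeros this is read as an element of $[0,\infty]$, the summand $(a-b)(\log a-\log b)$ being $+\infty$ if exactly one of $a,b$ is $0$ and $0$ if both are. Modified log-Sobolev constant: $\rho_0(\pi,P)$ is the largest number such that $\rho_0\,\mathrm{Ent}_\pi(f)\le\mathcal E_{\pi,P}(f,\log f)$ for all $f:\mathcal X\to\mathbb R_{\ge0}$. The implied constants in $O,\Theta,\Omega$ are universal, and the bounds are for all sufficiently large $M$. *)

(* Defs.v *)
From HB Require Import structures.
From mathcomp Require Import all_boot all_order all_algebra.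
From mathcomp Require Import all_classical all_reals all_analysis.
From mathcomp Require Import ring lra.

Set Implicit Arguments.
Unset Strict Implicit.
Unset Printing Implicit Defensive.

Import Order.TTheory GRing.Theory Num.Theory.
Import numFieldNormedType.Exports.

Local Open Scope classical_set_scope.
Local Open Scope ring_scope.

Section FiniteMarkov.
Context {R : realType} {X : finType}.
Implicit Types (nu pi : X -> R) (P : X -> X -> R) (f g : X -> R).

Definition is_distribution nu : Prop :=
  (forall x, 0 <= nu x) /\ \sum_x nu x = 1.

Definition is_markov_kernel P : Prop := forall x, is_distribution (P x).

Definition is_reversible pi P : Prop :=
  forall x y, pi x * P x y = pi y * P y x.

Definition push nu P : X -> R := fun y => \sum_x nu x * P x y.

(* The convention 0 log 0 = 0 is automatic: the factor [nu x] vanishes. *)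
Definition KL nu pi : \bar R :=
  if [forall x, (pi x == 0) ==> (nu x == 0)]
  then (\sum_x nu x * ln (nu x / pi x))%:E
  else +oo%E.

Definition entropy_contraction pi P : \bar R :=
  (1 - ereal_sup [set KL (push nu P) pi / KL nu pi
                 | nu in [set nu : X -> R | is_distribution nu
                                            /\ 0 < KL nu pi < +oo]])%E.

Definition mean pi f : R := \sum_x pi x * f x.

Definition Ent pi f : R := mean pi (fun x => f x * ln (f x / mean pi f)).

Definition dirichlet pi P f g : R :=
  - mean pi (fun x => f x * (\sum_y P x y * g y - g x)).

(* (a - b)(log a - log b) for a, b >= 0, with values in [0, +oo]. *)
Definition sub_mul_sub_ln (a b : R) : \bar R :=
  if (a == 0) && (b == 0) then 0%E
  else if (a == 0) || (b == 0) then +oo%E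
  else ((a - b) * (ln a - ln b))%:E.

(* E(f, log f) for f >= 0 and P reversible with respect to pi; see
   [dirichlet_lnE] for the agreement with [dirichlet] when f > 0. A pair with
   pi x * P x y = 0 contributes 0, since 0 * +oo = 0 in \bar R. *)
Definition dirichlet_ln pi P f : \bar R :=
  ((2^-1)%:E * \sum_x \sum_y (pi x * P x y)%:E * sub_mul_sub_ln (f x) (f y))%E.

Definition mlsi pi P : \bar R :=
  ereal_sup [set r%:E | r in [set r : R | forall f, (forall x, 0 <= f x) ->
                                ((r * Ent pi f)%:E <= dirichlet_ln pi P f)%E]].

Lemma dirichlet_lnE pi P f :
  is_markov_kernel P -> is_reversible pi P -> (forall x, 0 < f x) ->
  dirichlet_ln pi P f = (dirichlet pi P f (fun x => ln (f x)))%:E.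
Proof.
move=> mkP rev f0.
have E x y : sub_mul_sub_ln (f x) (f y) = ((f x - f y) * (ln (f x) - ln (f y)))%:E.
  by rewrite /sub_mul_sub_ln !gt_eqF.
rewrite /dirichlet_ln.
under eq_bigr => x _ do under eq_bigr => y _ do rewrite E -EFinM.
under eq_bigr => x _ do rewrite sumEFin.
rewrite sumEFin -EFinM; congr EFin.
pose a x y := pi x * P x y * (f x * ln (f x)).
pose b x y := pi x * P x y * (f x * ln (f y)).
have -> : \sum_x \sum_y pi x * P x y * ((f x - f y) * (ln (f x) - ln (f y))) =
   \sum_x \sum_y (a x y - b x y) + \sum_x \sum_y (a y x - b y x).
  rewrite -big_split; apply: eq_bigr => x _.
  rewrite -big_split; apply: eq_bigr => y _ /=.
  by rewrite /a /b -(rev x y); ring.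
rewrite [X in _ + X]exchange_big /=.
have -> : \sum_x \sum_y (a x y - b x y) = dirichlet pi P f (fun x => ln (f x)).
  rewrite /dirichlet /mean -sumrN; apply: eq_bigr => x _.
  rewrite sumrB -mulr_suml -mulr_sumr (mkP x).2.
  have -> : \sum_y b x y = pi x * f x * \sum_y P x y * ln (f y).
    by rewrite mulr_sumr; apply: eq_bigr => y _; rewrite /b; ring.
  ring.
lra.
Qed.

End FiniteMarkov.

Section Example.
Context {R : realType}.

(* The states 1, 2, 3 are the ordinals 0, 1, 2 of 'I_3. *)
Definition pi3 (M : R) : 'I_3 -> R := fun i =>
  nth 0 [:: M / (M + 2); 1 / (M + 2); 1 / (M + 2)] i.

Definition P3 (M : R) : 'I_3 -> 'I_3 -> R := fun i j =>
  nth 0 (nth [::] [:: [:: 1 - 1 / (4 * M); 1 / (4 * M); 0    ];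
                      [:: 1 / 4;           1 / 2;       1 / 4];
                      [:: 0;               1 / 4;       3 / 4]] i) j.

End Example.

(* Main.v *)
Require Import Defs.
From HB Require Import structures.
From mathcomp Require Import all_boot all_order all_algebra.
From mathcomp Require Import all_classical all_reals all_analysis.
From mathcomp Require Import ring lra.

Set Implicit Arguments.
Unset Strict Implicit.
Unset Printing Implicit Defensive.

Import Order.TTheory GRing.Theory Num.Theory.
Import numFieldNormedType.Exports.
Local Open Scope classical_set_scope.
Local Open Scope ring_scope.

(** A common mass [k y] in all the rows of a kernel contracts [KL] by the factor
    [1 - \sum_y k y], so the contraction coefficient is positive; the point mass
    at the last state loses only a bounded amount of its entropy [ln (M + 2)] in
    one step, so the coefficient is [O(1 / ln M)].

    For the modified log-Sobolev constant normalise [f = (1, b, c)].  Both edges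
    have the same weight, and by the variational formula for the entropy one has
    to compare [c * min (ln c) (ln M)] with
    [(b - 1) ln b + (c - b) (ln c - ln b)].  If [b] is at least
    [c / sqrt (ln M)], the first edge pays with a loss [sqrt (ln M)]; otherwise
    the second edge pays at least [c ln (ln M) / 4].  The function
    [(1, M / ln M, M)] shows that this is sharp. *)

(** * Convexity inequalities for the logarithm *)

Section LnInequalities.
Context {R : realType}.
Implicit Types a b c x y s : R.

Lemma ln_le_subr1 x : 0 < x -> ln x <= x - 1.
Proof.
by move=> x0; have := @le_ln1Dx R (x - 1); rewrite addrCA subrr addr0; apply; lra.
Qed.

Lemma ler_wln x y : 0 < x -> x <= y -> ln x <= ln y.
Proof. by move=> x0 xy; rewrite ler_ln ?posrE // (lt_le_trans x0). Qed.

Lemma subr_div_le_ln x y : 0 < x -> 0 < y -> 1 - y / x <= ln x - ln y.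
Proof.
move=> x0 y0; have := ln_le_subr1 (divr_gt0 y0 x0).
by rewrite ln_div ?posrE //; lra.
Qed.

(** Tangent line of the convex function [x * ln (x / y)] of [x] at the point [x = s * y]. *)
Lemma mul_ln_div_ge x y s : 0 <= x -> 0 <= y -> (y = 0 -> x = 0) -> 0 < s ->
  x * ln s + x - s * y <= x * ln (x / y).
Proof.
move=> x0 y0 xy s0; have [->|xN0] := eqVneq x 0.
  by rewrite !mul0r addr0 add0r oppr_le0 mulr_ge0 // ltW.
have {}x0 : 0 < x by rewrite lt_def xN0.
have {}y0 : 0 < y.
  by rewrite lt_def y0 andbT; apply: contra_neq xN0.
have := subr_div_le_ln (divr_gt0 x0 y0) s0.
rewrite invf_div mulrA => h.
have -> : x * ln s + x - s * y = x * (ln s + (1 - s * y / x)).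
  by field; rewrite xN0.
by rewrite ler_pM2l //; lra.
Qed.

Lemma sub_mul_sub_ln_ge0 x y : 0 < x -> 0 < y -> 0 <= (x - y) * (ln x - ln y).
Proof.
move=> x0 y0; have [xy|yx] := leP x y.
  by have := ler_wln x0 xy; nra.
by have := ler_wln y0 (ltW yx); nra.
Qed.

(** The slope of [ln] on []0, s]] is at least [1 / s], so for bounded values the logarithmic energy
    dominates the quadratic one. *)
Lemma sqr_sub_le x y s : 0 < x -> 0 < y -> x <= s -> y <= s ->
  (x - y) ^+ 2 <= s * ((x - y) * (ln x - ln y)).
Proof.
wlog yx : x y / y <= x.
  move=> H x0 y0 xs ys; have [yx|/ltW xy] := leP y x; first exact: H.
  by have := H _ _ xy y0 x0 ys xs; lra.
move=> x0 y0 xs ys; have h := subr_div_le_ln x0 y0.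
have h2 : x - y <= x * (ln x - ln y).
  have -> : x - y = x * (1 - y / x) by field; rewrite gt_eqF.
  by rewrite ler_pM2l.
have h3 : x * (ln x - ln y) <= s * (ln x - ln y).
  by rewrite ler_wpM2r // subr_ge0 ler_wln.
rewrite expr2 mulrCA ler_wpM2l ?subr_ge0 //; exact: le_trans h3.
Qed.

End LnInequalities.

(** * One-step decay of the relative entropy *)

Section Contraction.
Context {R : realType} {X : finType}.
Implicit Types (nu pi k : X -> R) (P : X -> X -> R).

Lemma KL_pos nu pi : (forall x, 0 < pi x) ->
  KL nu pi = (\sum_x nu x * ln (nu x / pi x))%:E.
Proof.
move=> pi0; rewrite /KL ifT //; apply/forallP => x.
by rewrite gt_eqF.
Qed.

Lemma is_reversible_stationary pi P :
  is_markov_kernel P -> is_reversible pi P -> push pi P = pi.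
Proof.
move=> mkP rev; apply/funext => y; rewrite /push.
under eq_bigr do rewrite rev.
by rewrite -mulr_sumr (mkP y).2 mulr1.
Qed.

(* Tangent line of [t ln t] at [s = (nu P)(y) / pi y], summed against
   [P x y - k y]: the removed mass [k y] contributes [ln s + 1 - s <= 0]. *)
Lemma KL_push_le nu pi P k :
  (forall x, 0 < pi x) -> \sum_x pi x = 1 -> push pi P = pi ->
  is_markov_kernel P -> is_distribution nu ->
  (forall x y, k y <= P x y) -> (forall y, 0 <= k y) ->
  (KL (push nu P) pi <= (1 - \sum_y k y)%:E * KL nu pi)%E.
Proof.
move=> pi0 pi1 piP mkP [nu0 nu1] kP k0.
rewrite !KL_pos // -EFinM lee_fin.
have -> : (1 - \sum_y k y) * (\sum_x nu x * ln (nu x / pi x)) =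
    \sum_y \sum_x (P x y - k y) * (nu x * ln (nu x / pi x)).
  rewrite exchange_big /= mulr_sumr; apply: eq_bigr => x _.
  by rewrite -mulr_suml sumrB (mkP x).2.
apply: ler_sum => y _.
have pushk : \sum_x (P x y - k y) * nu x = push nu P y - k y.
  rewrite -[X in _ = _ - X]mulr1 -nu1 mulr_sumr -sumrB.
  by apply: eq_bigr => x _; ring.
have pik : \sum_x (P x y - k y) * pi x = pi y - k y.
  rewrite -[X in _ = X - _](congr1 (@^~ y) piP) -[X in _ = _ - X]mulr1 -pi1.
  by rewrite mulr_sumr -sumrB; apply: eq_bigr => x _; ring.
have Pk0 x : 0 <= P x y - k y by rewrite subr_ge0.
have push_k : 0 <= push nu P y - k y.
  by rewrite -pushk; apply: sumr_ge0 => x _; rewrite mulr_ge0.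
(* If no mass reaches [y], then [k y = 0] and every [(P x y - k y) * nu x] vanishes, so both sides
   are 0. *)
have [p0|pN0] := eqVneq (push nu P y) 0.
  rewrite p0 mul0r; apply: sumr_ge0 => x _.
  have -> : (P x y - k y) * (nu x * ln (nu x / pi x)) = 0; last exact: lexx.
  have ky : k y = 0 by apply/eqP; rewrite eq_le k0 andbT; lra.
  have : \sum_x (P x y - k y) * nu x == 0 by rewrite pushk p0 ky subrr.
  rewrite psumr_eq0; last by move=> i _; rewrite mulr_ge0.
  by move=> /allP/(_ x (mem_index_enum _))/eqP H; rewrite mulrA H mul0r.
have push_gt0 : 0 < push nu P y.
  by rewrite lt_def pN0 /=; have := k0 y; lra.
set s := push nu P y / pi y; have s0 : 0 < s by rewrite divr_gt0.
apply: (@le_trans _ _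
    (\sum_x (P x y - k y) * (nu x * ln s + nu x - s * pi x))); last first.
  apply: ler_sum => x _; apply: ler_wpM2l => //.
  by apply: mul_ln_div_ge => //; [exact: ltW|move/eqP; rewrite gt_eqF].
have -> : \sum_x (P x y - k y) * (nu x * ln s + nu x - s * pi x) =
    (ln s + 1) * (push nu P y - k y) - s * (pi y - k y).
  rewrite -pushk -pik !mulr_sumr -sumrB.
  by apply: eq_bigr => x _; ring.
have spi : s * pi y = push nu P y by rewrite /s divfK // gt_eqF.
have := ln_le_subr1 s0; have := k0 y; nra.
Qed.

End Contraction.

(** * Entropy against energy for the function [(1, b, c)] *)

Section PathEnergy.
Context {R : realType}.
Implicit Types a b c x y s w M : R.

(* The Dirichlet form of [(1, b, c)], up to the common edge weight
   [pi x * P x y = 1 / (4 (M + 2))]. *)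
Definition path_energy b c : R :=
  (b - 1) * ln b + (b - c) * (ln b - ln c).

Lemma subr1_mul_ln_ge0 b : 0 < b -> 0 <= (b - 1) * ln b.
Proof.
by move=> b0; have := sub_mul_sub_ln_ge0 b0 (@ltr01 R); rewrite ln1 subr0.
Qed.

Lemma path_energy_ge b c : 0 < b -> 0 < c ->
  (b - 1) * ln b <= path_energy b c /\
  (b - c) * (ln b - ln c) <= path_energy b c.
Proof.
move=> b0 c0; have := subr1_mul_ln_ge0 b0; have := sub_mul_sub_ln_ge0 b0 c0.
by rewrite /path_energy; lra.
Qed.

(** The first edge pays for the entropy of the middle state. *)
Lemma mul_ln_sub_le b : 0 < b -> b * ln b - b + 1 <= (b - 1) * ln b.
Proof. by move=> b0; have := ln_le_subr1 b0; lra. Qed.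

(** For values up to 16 both sides compare with squares: the left one is at most
    [(c - 1)^2 <= 2 (b - 1)^2 + 2 (b - c)^2], and [sqr_sub_le] with [s = 16] gives the factor 32. If
    [c <= b], a single edge pays by monotonicity, except for [b < 1], where squares serve again with
    [s = 1]. *)
Lemma path_energy_near b c : 0 < b -> 0 < c -> (c <= 16) || (c <= b) ->
  c * ln c - c + 1 <= 32 * path_energy b c.
Proof.
move=> b0 c0 bc; have [h1 h2] := path_energy_ge b0 c0.
have q0 := subr1_mul_ln_ge0 b0.
have hc := mul_ln_sub_le c0.
have hsq : c * ln c - c + 1 <= (c - 1) ^+ 2.
  by have := ler_wpM2l (ltW c0) (ln_le_subr1 c0); lra.
have hbc : (c - 1) ^+ 2 <= 2 * (b - 1) ^+ 2 + 2 * (b - c) ^+ 2.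
  by have := sqr_ge0 ((b - 1) + (b - c)); lra.
have [cb|bltc] := leP c b.
  have lcb := ler_wln c0 cb.
  have [c1|c1] := leP 1 c.
    have lc := ln_ge0 c1.
    have : (c - 1) * ln c <= (b - 1) * ln b by apply: ler_pM; lra.
    by lra.
  have [b1|b1] := leP 1 b.
    have l1 := ln_ge0 b1; have l2 := ln_le0 (ltW c1).
    have : (1 - c) * (- ln c) <= (b - c) * (ln b - ln c).
      by apply: ler_pM; lra.
    by lra.
  have s1 := sqr_sub_le b0 (@ltr01 R) (ltW b1) (lexx _).
  have s2 := sqr_sub_le b0 c0 (ltW b1) (ltW c1).
  by rewrite ln1 subr0 in s1; rewrite /path_energy in h1 h2 *; lra.
have c16 : c <= 16 by case/orP: bc => //; lra.
have b16 : b <= 16 by lra.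
have s1 := @sqr_sub_le _ _ 1 16 b0 (@ltr01 R) b16 ltac:(lra).
have s2 := sqr_sub_le b0 c0 b16 c16.
by rewrite ln1 subr0 in s1; rewrite /path_energy; lra.
Qed.

(** Meant for [s = sqrt (ln M)] and [w = min (ln c) (ln M)]; the cases ask which edge carries the
    climb from 1 to [c]. *)
Lemma path_energy_far b c s w :
  0 < b -> b < c -> 16 <= c -> 4 <= s -> 1 <= ln s ->
  0 <= w -> w <= ln c -> w <= s ^+ 2 ->
  c * w * ln s <= 8 * s ^+ 2 * path_energy b c.
Proof.
move=> b0 bc c16 s4 l1 w0 wc ws.
have c0 : 0 < c by lra.
have s0 : 0 < s by lra.
have [h1 h2] := path_energy_ge b0 c0.
have ls := ln_le_subr1 s0.
set l := ln s in l1 ls *; set q := path_energy b c in h1 h2 *.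
have ln_half x : 0 < x -> c <= x ^+ 2 -> w <= 2 * ln x.
  move=> x0 cx; apply: (le_trans wc).
  by have := ler_wln c0 cx; rewrite lnXn // mulr2n; lra.
(* If [c / b > s], the log gap on the second edge exceeds [ln s] and its energy is at least
   [c / 2 * ln s]. *)
have [bs|sb] := ltP (b * s) c.
  have lbc : l <= ln c - ln b.
    have := ler_wln (mulr_gt0 b0 s0) (ltW bs).
    by rewrite lnM ?posrE // -/l; lra.
  have hcb : c / 2 <= c - b by nra.
  have q1 : c / 2 * l <= q.
    apply: (le_trans _ h2); rewrite -[leRHS]mulrNN !opprB.
    by apply: ler_pM => //; lra.
  have : c * w * l <= c * s ^+ 2 * l.
    by rewrite ler_wpM2r ?ler_wpM2l //; lra.
  have : s ^+ 2 * (c / 2 * l) <= s ^+ 2 * q by rewrite ler_wpM2l // sqr_ge0.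
  have : 0 <= s ^+ 2 * q.
    by rewrite mulr_ge0 ?sqr_ge0 //; nra.
  nra.
(* Now [c / b <= s]. If also [s^2 <= c], then [c <= b^2], hence [w <= 2 ln b], and the first edge
   pays with the loss [c / b <= s]. *)
have [cs|sc] := leP (s ^+ 2) c.
  have cb2 : c <= b ^+ 2.
    rewrite -(@ler_pM2l _ c) // -expr2.
    have : c ^+ 2 <= (b * s) ^+ 2 by rewrite ler_pXn2r ?nnegrE //; nra.
    rewrite exprMn => /le_trans; apply.
    by rewrite mulrC ler_wpM2r // sqr_ge0.
  have b4 : 4 <= b.
    by rewrite -(@ler_pXn2r _ 2) ?nnegrE //; nra.
  have lb := ln_half _ b0 cb2.
  have q1 : b / 2 * (w / 2) <= q.
    by apply: (le_trans _ h1); apply: ler_pM; lra.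
  have cw : c * w <= b * s * w by rewrite ler_wpM2r.
  have q2 : c * w <= 4 * (s * q).
    by have := ler_wpM2l (ltW s0) q1; lra.
  have q0 : 0 <= q by apply: le_trans q1; rewrite mulr_ge0; lra.
  have : c * w * l <= 4 * (s * q) * s.
    by apply: ler_pM => //; rewrite ?mulr_ge0 //; lra.
  have : 0 <= s ^+ 2 * q by rewrite mulr_ge0 ?sqr_ge0.
  by lra.
have l2 : l * l <= s ^+ 2 by rewrite expr2; apply: ler_pM; lra.
(* For [c < s^2]: if [c <= 2 b], the first edge pays up to a constant; otherwise the second edge
   pays [c / 4], which suffices since [w <= 2 ln s] and [(ln s)^2 <= s^2]. *)
have [cb|cb] := leP c (b * 2).
  have cb2 : c <= b ^+ 2 by nra.
  have lb := ln_half _ b0 cb2.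
  have q1 : c / 4 * (w / 2) <= q.
    by apply: (le_trans _ h1); apply: ler_pM; lra.
  have q0 : 0 <= q by apply: le_trans q1; rewrite mulr_ge0; lra.
  have ls2 : l <= s ^+ 2 by nra.
  have : c * w * l <= (8 * q) * s ^+ 2.
    apply: ler_pM => //; rewrite ?mulr_ge0 //; lra.
  by lra.
have lbc : 2^-1 <= ln c - ln b.
  have := ler_wln (mulr_gt0 b0 (@ltr0n R 2)) (ltW cb).
  have := @subr_div_le_ln _ 2 1 (@ltr0n R 2) (@ltr01 R).
  by rewrite lnM ?posrE // ln1; lra.
have q1 : c / 2 * 2^-1 <= q.
  apply: (le_trans _ h2); rewrite -[leRHS]mulrNN !opprB.
  by apply: ler_pM => //; lra.
have w2 : w <= 2 * l by apply: ln_half => //; exact: ltW.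
have : c * w * l <= c * (2 * (l * l)).
  rewrite -mulrA ler_wpM2l ?(ltW c0) // mulrA ler_wpM2r //; lra.
have : c * (l * l) <= 4 * q * s ^+ 2.
  by apply: ler_pM => //; rewrite ?mulr_ge0 //; lra.
by lra.
Qed.

(* The test value is [t = 1], the value at the heavy state, unless [c > M],
   where [t = c / M] is the order of magnitude of the mean. *)
Lemma path_entropy_le M b c s : 0 < b -> 0 < c -> 0 < M ->
  4 <= s -> 1 <= ln s -> ln M = s ^+ 2 ->
  exists2 t, 0 < t &
    (M * (t - 1 - ln t) + (b * (ln b - ln t) - b + t)
      + (c * (ln c - ln t) - c + t)) * ln s <= 33 * s ^+ 2 * path_energy b c.
Proof.
move=> b0 c0 M0 s4 l1 LM.
have [h1 h2] := path_energy_ge b0 c0.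
have q0 : 0 <= path_energy b c by apply: le_trans h1; exact: subr1_mul_ln_ge0.
have hb := mul_ln_sub_le b0.
have ls : ln s <= s ^+ 2 by have := @ln_le_subr1 _ s; nra.
(* Taking [t = 1] removes the term in [M]. The middle state costs one unit of energy and the last
   state 32, whence 33. *)
have [near|] := boolP ((c <= 16) || (c <= b)).
  exists 1 => //; rewrite ln1 !subr0 subrr mulr0 add0r.
  have hc := path_energy_near b0 c0 near.
  apply: (@le_trans _ _ (33 * path_energy b c * ln s)).
    by rewrite ler_wpM2r; lra.
  by rewrite mulrAC ler_wpM2r // ler_wpM2l.
rewrite negb_or -!ltNge => /andP[c16 bc].
have Ls : 0 <= s ^+ 2 by rewrite sqr_ge0.
have qs : path_energy b c * ln s <= s ^+ 2 * path_energy b c.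
  by rewrite mulrC ler_wpM2r.
have [cM|Mc] := leP c M.
  exists 1 => //; rewrite ln1 !subr0 subrr mulr0 add0r.
  have lc0 : 0 <= ln c by apply: ln_ge0; lra.
  have lcM : ln c <= s ^+ 2 by rewrite -LM ler_wln.
  have far := path_energy_far b0 bc (ltW c16) s4 l1 lc0 (lexx _) lcM.
  apply: (@le_trans _ _ ((path_energy b c + c * ln c) * ln s)).
    by rewrite ler_wpM2r; lra.
  by rewrite mulrDl; nra.
have t0 : 0 < c / M by rewrite divr_gt0.
exists (c / M) => //.
have M1 : 1 <= M.
  by have := ln_le_subr1 M0; rewrite LM; lra.
have Mt : M * (c / M) = c by rewrite mulrC divfK ?gt_eqF.
have lt : ln (c / M) = ln c - s ^+ 2 by rewrite ln_div ?posrE // LM.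
have lt0 : 0 <= ln (c / M) by apply: ln_ge0; rewrite ler_pdivlMr // mul1r ltW.
have tc : c / M <= c by rewrite ler_pdivrMr // ler_peMr // ltW.
have lbc := ler_wln b0 (ltW bc).
have far := @path_energy_far b c s (s ^+ 2) b0 bc (ltW c16) s4 l1 Ls.
have {}far : c * s ^+ 2 * ln s <= 8 * s ^+ 2 * path_energy b c.
  by apply: far => //; lra.
(* As [ln c - ln t = s^2], the three terms add up to at most [3 c s^2], which [path_energy_far] with
   [w = s^2] bounds. *)
apply: (@le_trans _ _ (3 * (c * s ^+ 2) * ln s)); last by nra.
rewrite ler_wpM2r //; first by lra.
have e1 : M * (c / M - 1 - ln (c / M)) <= c.
  by rewrite !mulrBr Mt; nra.
have e2 : b * (ln b - ln (c / M)) <= c * s ^+ 2.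
  apply: (@le_trans _ _ (b * s ^+ 2)); last by rewrite ler_wpM2r // ltW.
  by rewrite ler_wpM2l ?lt; lra.
have e3 : c * (ln c - ln (c / M)) = c * s ^+ 2 by rewrite lt; congr (_ * _); ring.
have e4 : c * 2 <= c * s ^+ 2 by rewrite ler_wpM2l //; nra.
lra.
Qed.

End PathEnergy.

(** * Bounds on the contraction coefficient *)

Section EntropyContraction.
Context {R : realType} {X : finType}.
Implicit Types (nu pi k : X -> R) (P : X -> X -> R).

Lemma entropy_contraction_ge pi P k :
  (forall x, 0 < pi x) -> \sum_x pi x = 1 -> push pi P = pi ->
  is_markov_kernel P ->
  (forall x y, k y <= P x y) -> (forall y, 0 <= k y) ->
  ((\sum_y k y)%:E <= entropy_contraction pi P)%E.
Proof.
move=> pi0 pi1 piP mkP kP k0; rewrite /entropy_contraction.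
have -> : (\sum_y k y)%:E = (1 - (1 - \sum_y k y)%:E)%E.
  by rewrite -EFinB; congr EFin; ring.
apply: leeB => //; apply: ge_ereal_sup => _ [nu [dnu /andP[KL0 _]]] <-.
have := KL_push_le pi0 pi1 piP mkP dnu kP k0.
move: KL0; rewrite !KL_pos // lte_fin -EFinM !lee_fin => KL0 le.
by rewrite inver gt_eqF // -EFinM lee_fin ler_pdivrMr.
Qed.

Lemma entropy_contraction_le pi P nu :
  is_distribution nu -> (0 < KL nu pi < +oo)%E ->
  (entropy_contraction pi P <= 1 - KL (push nu P) pi / KL nu pi)%E.
Proof.
move=> dnu KL0; rewrite /entropy_contraction; apply: leeB => //.
by apply: ereal_sup_ubound; exists nu.
Qed.

End EntropyContraction.

(** * Variational bound on the entropy; Dirichlet form of functions with zeros *)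

Section EntropyDirichlet.
Context {R : realType} {X : finType}.
Implicit Types (pi f : X -> R) (P : X -> X -> R).

Lemma EntE pi f : (forall x, 0 < f x) -> 0 < mean pi f ->
  Ent pi f = mean pi (fun x => f x * ln (f x)) - mean pi f * ln (mean pi f).
Proof.
move=> f0 m0; rewrite /Ent {1 2}/mean {1}/mean mulr_suml -sumrB.
by apply: eq_bigr => x _; rewrite ln_div ?posrE //; ring.
Qed.

(** With [m] the mean of [f], the right side exceeds the entropy by [m ln (m / t) - m + t >= 0]. The
    mean is thus replaced by a [t] of free choice. *)
Lemma Ent_le pi f t : \sum_x pi x = 1 -> (forall x, 0 < f x) ->
  0 < mean pi f -> 0 < t ->
  Ent pi f <= mean pi (fun x => f x * (ln (f x) - ln t) - f x + t).
Proof.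
move=> pi1 f0 m0 t0; rewrite EntE //.
have -> : mean pi (fun x => f x * (ln (f x) - ln t) - f x + t) =
    mean pi (fun x => f x * ln (f x)) - mean pi f * ln t - mean pi f + t.
  rewrite /mean -[X in _ = _ + X]mul1r -pi1 !mulr_suml -!sumrB -big_split /=.
  by apply: eq_bigr => x _; ring.
have tN0 : t = 0 -> mean pi f = 0 by move=> t00; rewrite t00 ltxx in t0.
have := mul_ln_div_ge (ltW m0) (ltW t0) tN0 (@ltr01 R).
by rewrite ln1 ln_div ?posrE //; lra.
Qed.

Lemma sub_mul_sub_lnE_ge0 (a b : R) : 0 <= a -> 0 <= b ->
  (0 <= sub_mul_sub_ln a b)%E.
Proof.
move=> a0 b0; rewrite /sub_mul_sub_ln; case: ifPn => // _.
case: ifPn => [//|]; rewrite negb_or => /andP[aN0 bN0].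
by rewrite lee_fin sub_mul_sub_ln_ge0 // lt_def ?aN0 ?bN0.
Qed.

Lemma dirichlet_ln_ge0 pi P f :
  (forall x y, 0 <= pi x * P x y) -> (forall x, 0 <= f x) ->
  (0 <= dirichlet_ln pi P f)%E.
Proof.
move=> w0 f0; rewrite /dirichlet_ln mule_ge0 ?lee_fin ?invr_ge0 //.
apply: sume_ge0 => x _; apply: sume_ge0 => y _.
by rewrite mule_ge0 ?lee_fin // sub_mul_sub_lnE_ge0.
Qed.

(** One infinite summand among nonnegative ones; this settles functions that vanish at only one end
    of an edge. *)
Lemma dirichlet_ln_pinfty pi P f x y :
  (forall x y, 0 <= pi x * P x y) -> (forall x, 0 <= f x) ->
  0 < pi x * P x y -> (f x == 0) != (f y == 0) ->
  dirichlet_ln pi P f = +oo%E.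
Proof.
move=> w0 f0 wxy fxy; rewrite /dirichlet_ln.
have term0 u v : (0 <= (pi u * P u v)%:E * sub_mul_sub_ln (f u) (f v))%E.
  by rewrite mule_ge0 ?lee_fin // sub_mul_sub_lnE_ge0.
have -> : (\sum_u \sum_v (pi u * P u v)%:E * sub_mul_sub_ln (f u) (f v) = +oo)%E.
  apply/eqP; rewrite -leye_eq (bigD1 x) //= (bigD1 y) //=.
  have -> : ((pi x * P x y)%:E * sub_mul_sub_ln (f x) (f y) = +oo)%E.
    rewrite /sub_mul_sub_ln; move: fxy.
    by case: (f x == 0); case: (f y == 0) => //= _; rewrite gt0_muley ?lte_fin.
  rewrite -addeA leeDl // adde_ge0 //; first exact: sume_ge0.
  by apply: sume_ge0 => u _; exact: sume_ge0.
by rewrite gt0_muley // lte_fin invr_gt0.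
Qed.

End EntropyDirichlet.

(** * The three-state chain *)

Section ThreeStates.
Context {R : realType}.
Implicit Types (M : R) (f : 'I_3 -> R).

(** The states are written in the form that [big_ord_recl] produces. *)
Local Notation i0 := (ord0 : 'I_3).
Local Notation i1 := (lift ord0 ord0 : 'I_3).
Local Notation i2 := (lift ord0 (lift ord0 ord0) : 'I_3).

Lemma ord3_ind (Q : 'I_3 -> Prop) : Q i0 -> Q i1 -> Q i2 -> forall i, Q i.
Proof.
move=> q0 q1 q2 [[|[|[|//]]] lti].
- by rewrite (_ : Ordinal lti = i0) //; exact: val_inj.
- by rewrite (_ : Ordinal lti = i1) //; exact: val_inj.
- by rewrite (_ : Ordinal lti = i2) //; exact: val_inj.
Qed.

Lemma sum_ord3 (V : nmodType) (F : 'I_3 -> V) :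
  \sum_i F i = F i0 + (F i1 + F i2).
Proof. by rewrite !big_ord_recl big_ord0 addr0. Qed.

Lemma pi3_gt0 M : 1 <= M -> forall x, 0 < pi3 M x.
Proof.
by move=> M1; apply: ord3_ind; rewrite /pi3 /= divr_gt0 //; lra.
Qed.

Lemma pi3_distribution M : 1 <= M -> is_distribution (pi3 M).
Proof.
move=> M1; split=> [x|]; first exact/ltW/pi3_gt0.
by rewrite sum_ord3 /pi3 /=; field; lra.
Qed.

Lemma P3_markov M : 1 <= M -> is_markov_kernel (P3 M).
Proof.
move=> M1; have v0 : 0 <= 1 / (4 * M) by rewrite divr_ge0 //; lra.
have v1 : 1 / (4 * M) <= 1 by rewrite ler_pdivrMr; lra.
apply: ord3_ind; (split; [apply: ord3_ind|rewrite sum_ord3]);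
  by rewrite /P3 /=; lra.
Qed.

Lemma P3_reversible M : 1 <= M -> is_reversible (pi3 M) (P3 M).
Proof.
move=> M1; apply: ord3_ind; apply: ord3_ind; rewrite /pi3 /P3 //=; field;
  by lra.
Qed.

Lemma mean_pi3 M f :
  mean (pi3 M) f = (M + 2)^-1 * (M * f i0 + f i1 + f i2).
Proof. by rewrite /mean sum_ord3 /pi3 /=; ring. Qed.

Lemma dirichlet_ln3 M f : 1 <= M -> (forall x, 0 < f x) ->
  dirichlet_ln (pi3 M) (P3 M) f =
  ((4 * (M + 2))^-1 * ((f i1 - f i0) * (ln (f i1) - ln (f i0))
    + (f i1 - f i2) * (ln (f i1) - ln (f i2))))%:E.
Proof.
move=> M1 f0; rewrite dirichlet_lnE //; [|exact: P3_markov|exact: P3_reversible].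
congr EFin; rewrite /dirichlet mean_pi3 !sum_ord3 /P3 /=.
field; lra.
Qed.

(** Positivity permits dropping the absolute value in the upper bound and dividing by the
    coefficient. *)
Lemma entropy_contraction3_gt0 M : 1 <= M ->
  (0 < entropy_contraction (pi3 M) (P3 M))%E.
Proof.
(* Only the column of [i1] has no zero; its smallest entry is [1 / (4 M)]. *)
move=> M1; pose k i : R := if i == i1 then 1 / (4 * M) else 0.
have v0 : 0 < 1 / (4 * M) by rewrite divr_gt0 //; lra.
have v1 : 1 / (4 * M) <= 1 / 4 by rewrite ler_pdivrMr; lra.
have [pi0 pi1] := pi3_distribution M1.
have mkP := P3_markov M1.
apply: lt_le_trans (entropy_contraction_ge (k := k) (pi3_gt0 M1) pi1
  (is_reversible_stationary mkP (P3_reversible M1)) mkP _ _).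
- by rewrite lte_fin sum_ord3 /k /= add0r addr0.
- move=> x y; rewrite /k; case: eqP => [->|_]; last exact: (mkP x).1.
  by move: x; apply: ord3_ind; rewrite /P3 /=; lra.
- by move=> y; rewrite /k; case: ifP => // _; exact: ltW.
Qed.

Lemma entropy_contraction3_le M : 1 <= M -> 1 <= ln M ->
  (entropy_contraction (pi3 M) (P3 M) <= ((ln M)^-1)%:E)%E.
Proof.
move=> M1 L1; pose nu (i : 'I_3) : R := if i == i2 then 1 else 0.
have lM : ln M <= ln (M + 2) by apply: ler_wln; lra.
have nuD : is_distribution nu.
  split; last by rewrite sum_ord3 /nu /= !add0r.
  by move=> x; rewrite /nu; case: ifP.
have KLnu : KL nu (pi3 M) = (ln (M + 2))%:E.
  rewrite KL_pos; last exact: pi3_gt0.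
  rewrite sum_ord3 /nu /pi3 /= !mul0r !add0r mul1r.
  by congr (ln _)%:E; field; lra.
have KL0 : (0 < KL nu (pi3 M) < +oo)%E.
  by rewrite KLnu lte_fin ltry andbT; lra.
apply: (le_trans (entropy_contraction_le (P3 M) nuD KL0)).
have M2 : 0 < M + 2 by lra.
(* One step leads to [(0, 1/4, 3/4)]; the loss is the Shannon entropy of the weights [1/4] and
   [3/4]. *)
have -> : KL (push nu (P3 M)) (pi3 M)
    = (ln (M + 2) - (ln 4 - 3 / 4 * ln 3))%:E.
  rewrite KL_pos; last exact: pi3_gt0.
  rewrite sum_ord3 /push !sum_ord3 /nu /pi3 /P3 /=.
  rewrite !mul0r !mul1r !add0r !mul0r add0r.
  have -> : 4^-1 / (M + 2)^-1 = (M + 2) / 4 :> R by field; lra.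
  have -> : 3 / 4 / (M + 2)^-1 = 3 * (M + 2) / 4 :> R by field; lra.
  rewrite !ln_div ?posrE ?mulr_gt0 // lnM ?posrE //.
  by congr EFin; lra.
rewrite KLnu inver gt_eqF; last by lra.
rewrite -EFinM -EFinB lee_fin.
have -> : 1 - (ln (M + 2) - (ln 4 - 3 / 4 * ln 3)) / ln (M + 2) =
    (ln 4 - 3 / 4 * ln 3) / ln (M + 2) by field; lra.
apply: (@le_trans _ _ (ln (M + 2))^-1); last first.
  by rewrite lef_pV2 ?posrE //; lra.
have lM2 : 0 < ln (M + 2) by lra.
rewrite ler_pdivrMr // mulVf ?gt_eqF //.
(* The loss is [(ln 4 - ln 3) + ln 3 / 4 <= 1/3 + 1/2 < 1]. *)
have l3 : ln 3 <= 3 - 1 :> R by apply: ln_le_subr1.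
have l43 : ln 4 - ln 3 <= 4 / 3 - 1 :> R.
  by rewrite -ln_div ?posrE //; apply: ln_le_subr1.
by lra.
Qed.

Lemma mlsi3_le M : 1 <= M -> 36 <= ln M -> 1 <= ln (ln M) ->
  (mlsi (pi3 M) (P3 M) <= (3 * (ln (ln M) / ln M))%:E)%E.
Proof.
move=> M1 L36 l1; set L := ln M in L36 l1 *; set l := ln L in l1 *.
apply: ge_ereal_sup => _ [r rP <-]; rewrite lee_fin mulrA.
have L0 : 0 < L by lra.
have M0 : 0 < M by lra.
have LM : L <= M by have := ln_le_subr1 M0; rewrite -/L; lra.
have ML : 1 <= M / L by rewrite ler_pdivlMr // mul1r.
have ML' : M / L <= M by rewrite ler_pdivrMr // ler_peMr; lra.
pose f (i : 'I_3) : R := nth 0 [:: 1; M / L; M] i.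
have f0 : forall x, 0 < f x by apply: ord3_ind; rewrite /f /=; lra.
have := rP f (fun x => ltW (f0 x)); rewrite dirichlet_ln3 // lee_fin.
rewrite /f /= ln1 !subr0 ln_div ?posrE // -/L -/l -/f => rE.
have M2 : 0 < (M + 2)^-1 by rewrite invr_gt0; lra.
have VM : (M + 2)^-1 * (M + 2) = 1 by rewrite mulVf // gt_eqF //; lra.
have lL : 0 <= L - l by have := ln_le_subr1 L0; rewrite -/l; lra.
have mE : mean (pi3 M) f = (M + 2)^-1 * (M + M / L + M).
  by rewrite mean_pi3 /f /= mulr1.
have m0 : 0 < mean (pi3 M) f by rewrite mE mulr_gt0 //; lra.
have m3 : mean (pi3 M) f <= 3.
  have -> : 3 = (M + 2)^-1 * (M + 2) * 3 :> R by rewrite VM mul1r.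
  by rewrite mE -mulrA ler_wpM2l //; lra.
(* The last state alone gives [L / 3], since [(M + 2) / 3 <= M]; the correction [m ln m <= 6] is at
   most [L / 6] because [L >= 36]. *)
have Ent6 : L / 6 <= Ent (pi3 M) f.
  rewrite EntE // mean_pi3 /f /= ln1 mulr0 mulr0 add0r ln_div ?posrE //.
  rewrite -/L -/l -/f.
  set m := mean _ _ in m0 m3 *.
  have mm : m * ln m <= 6.
    by have := ler_wpM2l (ltW m0) (ln_le_subr1 m0); nra.
  have : (M + 2)^-1 * ((M + 2) / 3 * L) <=
      (M + 2)^-1 * (M / L * (L - l) + M * L).
    apply: ler_wpM2l; first exact: ltW.
    have : 0 <= M / L * (L - l) by rewrite mulr_ge0 //; lra.
    have : (M + 2) / 3 * L <= M * L by rewrite ler_wpM2r //; lra.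
    by lra.
  rewrite !mulrA VM; lra.
(* Each edge contributes at most [M * l] before the common weight. *)
have El : r * Ent (pi3 M) f <= l / 2.
  apply: (le_trans rE).
  have e1 : (M / L - 1) * (L - l) <= M.
    apply: (@le_trans _ _ (M / L * L)); last by rewrite divfK // gt_eqF.
    by apply: ler_pM; lra.
  have e2 : (M / L - M) * (L - l - L) <= M * l.
    rewrite -[leLHS]mulrNN; apply: ler_pM; lra.
  have -> : l / 2 = (4 * (M + 2))^-1 * (2 * l * (M + 2)) by field; lra.
  apply: ler_wpM2l; first by rewrite invr_ge0; lra.
  by have := ler_wpM2l (ltW M0) l1; lra.
rewrite ler_pdivlMr //.
have [r0|r0] := leP r 0; first by nra.
by have := ler_wpM2l (ltW r0) Ent6; lra.
Qed.

(** The constant is [264 = 33 * 4 * 2]: 33 from [path_entropy_le], 4 from the edge weight, 2 from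
    [ln (ln M) = 2 ln s]. *)
Lemma mlsi3_ge M : 1 <= M -> 16 <= ln M -> 2 <= ln (ln M) ->
  ((264^-1 * (ln (ln M) / ln M))%:E <= mlsi (pi3 M) (P3 M))%E.
Proof.
move=> M1 L16 l2; set r := _ * _.
have M0 : 0 < M by lra.
have L0 : 0 < ln M by lra.
apply: ereal_sup_ubound; exists r => // f f0.
have w0 x y : 0 <= pi3 M x * P3 M x y.
  by rewrite mulr_ge0 ?(ltW (pi3_gt0 M1 _)) // (P3_markov M1 x).1.
have pos01 : 0 < pi3 M i1 * P3 M i1 i0.
  by rewrite mulr_gt0 ?pi3_gt0 // /P3 /=; lra.
have pos12 : 0 < pi3 M i1 * P3 M i1 i2.
  by rewrite mulr_gt0 ?pi3_gt0 // /P3 /=; lra.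
(* The two edges connect all states, so finite energy forces [f] to vanish everywhere or nowhere. *)
have [e0|/(dirichlet_ln_pinfty w0 f0 pos01) ->] :=
  eqVneq (f i1 == 0) (f i0 == 0); last by rewrite leey.
have [e2|/(dirichlet_ln_pinfty w0 f0 pos12) ->] :=
  eqVneq (f i1 == 0) (f i2 == 0); last by rewrite leey.
have [f1|f1] := eqVneq (f i1) 0.
  have fx : forall x, f x = 0.
    by rewrite f1 eqxx in e0 e2; apply: ord3_ind => //; apply/eqP.
  rewrite /Ent /mean big1 ?mulr0; last by move=> x _; rewrite fx mul0r mulr0.
  exact: dirichlet_ln_ge0.
have {}f0 : forall x, 0 < f x.
  rewrite (negbTE f1) in e0 e2.
  by apply: ord3_ind; rewrite lt_def f0 andbT // -?e0 -?e2.
have [m0 m1 m2] := And3 (f0 i0) (f0 i1) (f0 i2).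
rewrite dirichlet_ln3 // lee_fin.
set s := Num.sqrt (ln M).
have s2 : ln M = s ^+ 2 by rewrite sqr_sqrtr // ltW.
have s4 : 4 <= s by rewrite -(@ler_pXn2r _ 2) ?nnegrE ?sqrtr_ge0 // -s2; lra.
have lns : ln (ln M) = 2 * ln s by rewrite s2 lnXn ?mulr2n; lra.
have b0 := divr_gt0 m1 m0; have c0 := divr_gt0 m2 m0.
have [|t t0 ht] := path_entropy_le b0 c0 M0 s4 _ s2; first by lra.
set N := (X in X * ln s) in ht; set q := path_energy _ _ in ht.
have VM : 0 < (M + 2)^-1 by rewrite invr_gt0; lra.
(* By homogeneity the test value for [f = f i0 * (1, b, c)] is [t * f i0]. *)
have EN : Ent (pi3 M) f <= (M + 2)^-1 * (f i0 * N).
  apply: le_trans (Ent_le (pi3_distribution M1).2 f0 _ (mulr_gt0 t0 m0)) _.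
    by rewrite mean_pi3 mulr_gt0 // !addr_gt0 ?mulr_gt0.
  rewrite mean_pi3 ler_wpM2l ?(ltW VM) // /N !ln_div ?posrE // lnM ?posrE //.
  rewrite le_eqVlt; apply/orP; left; apply/eqP; field.
  by rewrite gt_eqF.
have -> : (f i1 - f i0) * (ln (f i1) - ln (f i0)) +
    (f i1 - f i2) * (ln (f i1) - ln (f i2)) = f i0 * q.
  rewrite /q /path_energy !ln_div ?posrE //; field; by rewrite gt_eqF.
have r0 : 0 < r by rewrite /r !mulr_gt0 ?invr_gt0 //; lra.
apply: (le_trans (ler_wpM2l (ltW r0) EN)).
have -> : r * ((M + 2)^-1 * (f i0 * N)) =
  ((M + 2)^-1 * f i0) * (132^-1 * (N * ln s) / s ^+ 2).
  by rewrite /r lns s2; field; lra.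
have -> : (4 * (M + 2))^-1 * (f i0 * q) = ((M + 2)^-1 * f i0) * (q / 4).
  by field; lra.
apply: ler_wpM2l; first by rewrite mulr_ge0 // ltW.
by rewrite ler_pdivrMr ?exprn_gt0; lra.
Qed.

End ThreeStates.

(** * Assembly of the bounds for large [M] *)

Theorem proposition21 (R : realType) :
  (forall M : R, 1 <= M ->
     [/\ is_distribution (pi3 M), is_markov_kernel (P3 M)
       & is_reversible (pi3 M) (P3 M)])
  /\ (exists2 C : R, 0 < C & \forall M \near +oo,
        (`|entropy_contraction (pi3 M) (P3 M)| <= (C / ln M)%:E)%E)
  /\ (exists c C : R, [/\ 0 < c, 0 < C & \forall M \near +oo,
        ((c * (ln (ln M) / ln M))%:E <= mlsi (pi3 M) (P3 M)
          <= (C * (ln (ln M) / ln M))%:E)%E])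
  /\ (exists2 c : R, 0 < c & \forall M \near +oo,
        (0 < entropy_contraction (pi3 M) (P3 M))%E /\
        ((c * ln (ln M))%:E
          <= mlsi (pi3 M) (P3 M) / entropy_contraction (pi3 M) (P3 M))%E).
Proof.
have large (M : R) : expR (expR 36) <= M ->
    [/\ 1 <= M, 36 <= ln M & 36 <= ln (ln M)].
  have e36 : 1 + 36 <= expR (36 : R) := expR_ge1Dx _.
  have e1 : 1 + expR (36 : R) <= expR (expR 36) := expR_ge1Dx _.
  move=> hM; have hL : expR 36 <= ln M.
    by rewrite -[leLHS]expRK ler_wln // expR_gt0.
  have hl : 36 <= ln (ln M) by rewrite -[leLHS]expRK ler_wln // expR_gt0.
  by split; lra.
have near_large (Q : R -> Prop) :
    (forall M, 1 <= M -> 36 <= ln M -> 36 <= ln (ln M) -> Q M) ->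
    \forall M \near +oo, Q M.
  move=> QP; near=> M; have [] := large M; last exact: QP.
  by near: M; exact: nbhs_pinfty_ge (num_real _).
split; [|split; [|split]].
- move=> M M1; split;
    [exact: pi3_distribution|exact: P3_markov|exact: P3_reversible].
- exists 1 => //; apply: near_large => M M1 L36 _.
  rewrite gee0_abs ?div1r; last exact/ltW/entropy_contraction3_gt0.
  by apply: entropy_contraction3_le; lra.
- exists 264^-1, 3; split => //.
  apply: near_large => M M1 L36 l36; apply/andP; split.
    by apply: mlsi3_ge; lra.
  by apply: mlsi3_le; lra.
- exists 264^-1 => //.
  apply: near_large => M M1 L36 l36.
  have d0 := entropy_contraction3_gt0 M1; split=> //.
  have dle := @entropy_contraction3_le _ M M1 ltac:(lra).
  have rge := @mlsi3_ge _ M M1 ltac:(lra) ltac:(lra).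
  (* The coefficient lies in []0, 1 / ln M]], so the extended quotient is a division by a positive
     real [d], and [d <= 1 / ln M] turns [rge] into the claim. *)
  have dfin : entropy_contraction (pi3 M) (P3 M) \is a fin_num.
    by rewrite ge0_fin_numE ?(ltW d0) // (le_lt_trans dle) // ltry.
  move: d0 dle; rewrite -(fineK dfin); set d := fine _.
  rewrite lte_fin lee_fin => d0 dle.
  rewrite inver gt_eqF // lee_pdivlMr //; apply: le_trans rge.
  rewrite -EFinM lee_fin -mulrA ler_wpM2l ?invr_ge0 //.
  by apply: ler_wpM2l => //; lra.
Unshelve. all: by end_near.
Qed.
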